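(* Let $\rho: l\to r\Leftarrow s_1\twoheadrightarrow t_1;\dots;s_k\twoheadrightarrow t_k$ be an extended deterministic conditional rewrite rule, and for $1\le i\le k$ let $X_i=\mathrm{Var}(l,t_1,\dots,t_{i-1})$ and $Y_i=\mathrm{Var}(r,t_i,s_{i+1},t_{i+1},\dots,s_k,t_k)$. Then: (1) $\rho$ is $\mathbb{U}_{\mathrm{opt}}$-LL iff all of $l,t_1,\dots,t_k$ are linear and $\mathrm{Var}(t_i)\cap X_i=\emptyset$ for all $1\le i\le k$; (2) $\rho$ is $\mathbb{U}_{\mathrm{opt}}$-RL iff all of $r,s_1,\dots,s_k$ are linear and $\mathrm{Var}(s_i)\cap Y_i=\emptyset$ for all $1\le i\le k$; (3) $\rho$ is $\mathbb{U}_{\mathrm{opt}}$-NE iff $\mathrm{Var}(l)\subseteq\mathrm{Var}(r,s_1,\dots,s_k)$ and $\mathrm{Var}(t_i)\subseteq\mathrm{Var}(r,s_{i+1},\dots,s_k)$ for all $1\le i\le k$.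
   Context: $\mathrm{Var}(t_1,\dots,t_n)$ is the set of variables occurring in the terms; a term is linear if no variable occurs in it twice. An extended conditional rewrite rule $l\to r\Leftarrow s_1\twoheadrightarrow t_1;\dots;s_k\twoheadrightarrow t_k$ ($k\ge0$; $l$ may be a variable) is deterministic if $\mathrm{Var}(s_i)\subseteq\mathrm{Var}(l,t_1,\dots,t_{i-1})$ for all $i$. An unconditional rule $l\to r$ is LL if $l$ is linear, RL if $r$ is linear, NE if $\mathrm{Var}(l)\subseteq\mathrm{Var}(r)$. Optimized unraveling of $\rho$ with $k\ge1$: with $Z_i=X_i\cap Y_i$, $\overrightarrow{X}$ the list of the elements of a finite variable set $X$ in a fixed order (without repetition), and fresh function symbols $U^\rho_1,\dots,U^\rho_k$: $\mathbb{U}_{\mathrm{opt}}(\rho)=\{l\to U^\rho_1(s_1,\overrightarrow{Z_1})\}\cup\{U^\rho_i(t_i,\overrightarrow{Z_i})\to U^\rho_{i+1}(s_{i+1},\overrightarrow{Z_{i+1}})\mid 1\le i<k\}\cup\{U^\rho_k(t_k,\overrightarrow{Z_k})\to r\}$; for $k=0$, $\mathbb{U}_{\mathrm{opt}}(\rho)=\{l\to r\}$. For a property P of unconditional rules, $\rho$ is $\mathbb{U}_{\mathrm{opt}}$-P if every rule in $\mathbb{U}_{\mathrm{opt}}(\rho)$ has P. *)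

(* Defs.v *)
From mathcomp Require Import all_boot.
From mathcomp Require Export finmap.

Set Implicit Arguments.
Unset Strict Implicit.
Unset Printing Implicit Defensive.

Local Open Scope fset_scope.

(* A signature is a type [F] of symbols with an arity function [ar]. *)
Inductive term (F : Type) (ar : F -> nat) (V : Type) : Type :=
| TVar of V
| TApp (f : F) of {ffun 'I_(ar f) -> term ar V}.

Arguments TVar {F ar V} x.
Arguments TApp {F ar V} f a.

(* The occurrences of variables, from left to right, with repetitions. *)
Fixpoint occ (F : Type) (ar : F -> nat) (V : Type) (t : term ar V) : seq V :=
  match t with
  | TVar x => [:: x]
  | TApp f a => flatten [seq occ (a i) | i <- enum 'I_(ar f)]
  end.

Definition vars (F : Type) (ar : F -> nat) (V : choiceType) (t : term ar V) :
  {fset V} := [fset x in occ t].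

Definition linear (F : Type) (ar : F -> nat) (V : choiceType)
  (t : term ar V) : bool := uniq (occ t).

Record rule (F : Type) (ar : F -> nat) (V : Type) : Type :=
  Rule { rl : term ar V; rr : term ar V }.

Definition LL (F : Type) (ar : F -> nat) (V : choiceType) (q : rule ar V) :
  Prop := linear (rl q).

Definition RL (F : Type) (ar : F -> nat) (V : choiceType) (q : rule ar V) :
  Prop := linear (rr q).

Definition NE (F : Type) (ar : F -> nat) (V : choiceType) (q : rule ar V) :
  Prop := vars (rl q) `<=` vars (rr q).

(* Extended rules: the left-hand side may be a variable. The conditions
   s_1 ->> t_1; ...; s_k ->> t_k are indexed from 0 by 'I_k. *)
Record crule (F : Type) (ar : F -> nat) (V : Type) : Type := CRule {
  lhs : term ar V;
  rhs : term ar V;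
  ncond : nat;
  cs : 'I_ncond -> term ar V;
  ct : 'I_ncond -> term ar V }.

Section Unraveling.
Variables (F : Type) (ar : F -> nat) (V : choiceType) (rho : crule ar V).

Definition Xvars (i : 'I_(ncond rho)) : {fset V} :=
  vars (lhs rho) `|` \bigcup_(j <- enum 'I_(ncond rho) | j < i) vars (ct j).

Definition Yvars (i : 'I_(ncond rho)) : {fset V} :=
  vars (rhs rho) `|` vars (ct i)
    `|` \bigcup_(j <- enum 'I_(ncond rho) | i < j) (vars (cs j) `|` vars (ct j)).

Definition Zvars (i : 'I_(ncond rho)) : {fset V} := Xvars i `&` Yvars i.

Definition deterministic : Prop :=
  forall i : 'I_(ncond rho), vars (cs i) `<=` Xvars i.

(* [lst X] is the list of the elements of X in the fixed order; see
   [listing] below. *)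
Variable lst : {fset V} -> seq V.

(* The signature extended with the fresh symbols U_i, where U_i takes one term
   and the variables of Z_i as arguments. *)
Definition Uar (f : F + 'I_(ncond rho)) : nat :=
  match f with
  | inl g => ar g
  | inr i => (size (lst (Zvars i))).+1
  end.

Fixpoint emb (t : term ar V) : term Uar V :=
  match t with
  | TVar x => TVar x
  | TApp f a => TApp (inl f : F + 'I_(ncond rho)) [ffun j => emb (a j)]
  end.

(* U_i(t, Z_i); the default value of [nth] is never reached. *)
Definition Uterm (i : 'I_(ncond rho)) (t : term ar V) : term Uar V :=
  TApp (inr i : F + 'I_(ncond rho))
    [ffun j : 'I_(size (lst (Zvars i))).+1 =>
       nth (emb t) (emb t :: [seq TVar x | x <- lst (Zvars i)]) j].

Inductive Uopt : rule Uar V -> Prop :=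
| Uopt_uncond :
    ncond rho = 0 -> Uopt (Rule (emb (lhs rho)) (emb (rhs rho)))
| Uopt_first (i : 'I_(ncond rho)) :
    val i = 0 -> Uopt (Rule (emb (lhs rho)) (Uterm i (cs i)))
| Uopt_step (i j : 'I_(ncond rho)) :
    val j = i.+1 -> Uopt (Rule (Uterm i (ct i)) (Uterm j (cs j)))
| Uopt_last (i : 'I_(ncond rho)) :
    i.+1 = ncond rho -> Uopt (Rule (Uterm i (ct i)) (emb (rhs rho))).

Definition Uopt_has (P : rule Uar V -> Prop) : Prop :=
  forall q, Uopt q -> P q.

End Unraveling.

Arguments Uopt {F ar V} rho lst q.
Arguments Uopt_has {F ar V} rho lst P.

Definition listing (V : choiceType) (lst : {fset V} -> seq V) : Prop :=
  forall X : {fset V}, uniq (lst X) /\ lst X =i X.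

(* Main.v *)
(* Since [vars (ct i)] lies in [Yvars i] and, by determinism, [vars (cs i)] lies
   in [Xvars i], linearity of U_i(t_i, Z_i) and U_i(s_i, Z_i) amounts to linearity
   of [ct i], [cs i] plus disjointness from the whole of [Xvars i], [Yvars i].
   For NE, the inclusions between consecutive rules chain downwards from the last
   one; conversely, a variable of [Yvars i] is in [cs i.+1], in [ct i] or in
   [Yvars i.+1]. *)
Require Import Defs.
From mathcomp Require Import all_boot.
From mathcomp Require Import finmap.

Local Open Scope fset_scope.

Section Unraveling.
Set Implicit Arguments.
Unset Strict Implicit.

Lemma in_vars (F : Type) (ar : F -> nat) (V : choiceType) (t : term ar V) x :
  (x \in vars t) = (x \in occ t).
Proof. by rewrite /vars inE. Qed.

Lemma ord_last_or_succ n (i : 'I_n) : i.+1 = n \/ exists j : 'I_n, val j = i.+1.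
Proof.
have := ltn_ord i; rewrite leq_eqVlt => /orP[/eqP|lt_in]; first by left.
by right; exists (Ordinal lt_in).
Qed.

Lemma ord_first_or_pred n (i : 'I_n) : val i = 0 \/ exists j : 'I_n, val i = j.+1.
Proof.
case: i => [[|m] lt_mn]; first by left.
by right; exists (Ordinal (ltnW lt_mn)).
Qed.

Variables (F : Type) (ar : F -> nat) (V : choiceType) (rho : crule ar V).
Implicit Types (t : term ar V) (i j : 'I_(ncond rho)).

Lemma XvarsP i x :
  reflect (x \in vars (lhs rho) \/ exists2 j : 'I_(ncond rho), j < i & x \in vars (ct j))
          (x \in Xvars i).
Proof.
rewrite /Xvars in_fsetU; apply: (iffP orP) => -[xl|]; [by left| |by left|].
  by case/bigfcupP => j /andP[_ ji] xj; right; exists j.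
by case=> j ji xj; right; apply/bigfcupP; exists j; rewrite // mem_enum.
Qed.

(** The summand [vars (ct i)] is absorbed into the range [i <= j], so that [ct] starts at [i] itself
    while [cs] starts strictly after it. *)
Lemma YvarsP i x :
  reflect [\/ x \in vars (rhs rho), exists2 j : 'I_(ncond rho), i <= j & x \in vars (ct j)
             | exists2 j : 'I_(ncond rho), i < j & x \in vars (cs j)]
          (x \in Yvars i).
Proof.
rewrite /Yvars !in_fsetU; apply: (iffP orP).
  case=> [/orP[xr|xi]|]; [by apply: Or31|by apply: Or32; exists i|].
  case/bigfcupP => j /andP[_ ij]; rewrite in_fsetU => /orP[xj|xj].
    by apply: Or33; exists j.
  by apply: Or32; exists j => //; apply: ltnW.
case=> [->|[j]|[j ij xj]]; first by left.
  rewrite leq_eqVlt => /orP[/eqP/val_inj<- ->|ij xj]; first by left; rewrite orbT.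
  right; apply/bigfcupP; exists j; first by rewrite mem_enum.
  by rewrite in_fsetU xj orbT.
right; apply/bigfcupP; exists j; first by rewrite mem_enum.
by rewrite in_fsetU xj.
Qed.

Lemma vars_ct_Yvars i : vars (ct i) `<=` Yvars i.
Proof. by apply/fsubsetP => x xi; apply/YvarsP/Or32; exists i. Qed.

Variable lst : {fset V} -> seq V.
Hypothesis lstP : listing lst.

Lemma occ_emb t : occ (emb rho lst t) = occ t.
Proof.
(* The arguments of [TApp] are nested inside a finite function, hence a direct structural
   recursion. *)
move: t; fix IH 1 => -[x|f a] //=.
by congr flatten; apply: eq_map => i; rewrite ffunE; apply: IH.
Qed.

Lemma vars_emb t : vars (emb rho lst t) = vars t.
Proof. by apply/fsetP => x; rewrite !in_vars occ_emb. Qed.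

Lemma linear_emb t : linear (emb rho lst t) = linear t.
Proof. by rewrite /linear occ_emb. Qed.

Lemma occ_Uterm i t : occ (Uterm lst i t) = occ t ++ lst (Zvars i).
Proof.
rewrite /= enum_ordSl /= ffunE /= occ_emb; congr (_ ++ _).
set L := lst _.
(* Each argument after the first is a variable, whose occurrences form a singleton. Reading these
   singletons off by index is a [mkseq] of [nth], and flattening them gives back [L]. *)
rewrite -map_comp (eq_map (g := fun j : 'I_(size L) => nth [::] [seq [:: x] | x <- L] j)).
  rewrite (map_comp (nth [::] _) val) val_enum_ord -(size_map (fun x => [:: x]) L).
  by rewrite -/(mkseq _ _) mkseq_nth flatten_seq1.
move=> j /=; rewrite ffunE /=.
(* [V] may be empty: the index [j] below [size L] shows that [L] is not, and its head serves as
   default for [nth]. *)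
have x0 : V by case: (L) j => [[]|x s _].
by rewrite (nth_map x0) ?ltn_ord // (nth_map x0) ?ltn_ord //.
Qed.

Lemma vars_Uterm i t : vars (Uterm lst i t) = vars t `|` Zvars i.
Proof.
apply/fsetP => x; rewrite in_vars occ_Uterm mem_cat in_fsetU in_vars.
by rewrite (lstP (Zvars i)).2.
Qed.

(** The listing has no duplicates, so a repetition not already in [t] must be a variable shared by
    [t] and the listing. *)
Lemma linear_Uterm i t :
  linear (Uterm lst i t) = linear t && (vars t `&` Zvars i == fset0).
Proof.
have [uL memL] := lstP (Zvars i).
rewrite /linear occ_Uterm cat_uniq uL andbT; congr (_ && _).
apply/hasPn/eqP => [nex|eq0 x].
  apply/fsetP => x; rewrite in_fsetI in_vars in_fset0; apply/negP => /andP[xt xZ].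
  by have := nex x; rewrite memL xZ xt => /(_ isT).
rewrite memL => xZ; apply/negP => xt.
by have := in_fset0 x; rewrite -eq0 in_fsetI in_vars xZ andbT => /negP.
Qed.

Lemma linear_Uterm_ct i :
  linear (Uterm lst i (ct i)) = linear (ct i) && (vars (ct i) `&` Xvars i == fset0).
Proof.
rewrite linear_Uterm /Zvars (fsetIC (Xvars i)) fsetIA.
by rewrite (fsetIidPl (vars_ct_Yvars i)).
Qed.

Lemma linear_Uterm_cs i : deterministic rho ->
  linear (Uterm lst i (cs i)) = linear (cs i) && (vars (cs i) `&` Yvars i == fset0).
Proof. by move=> det; rewrite linear_Uterm fsetIA (fsetIidPl (det i)). Qed.

(** Each of these terms is indeed a left side: [emb (lhs rho)] in the unconditional or first rule,
    [Uterm i (ct i)] in a step or the last rule. No other left side arises. *)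
Lemma Uopt_LL :
  Uopt_has rho lst (@LL _ _ V) <->
    linear (lhs rho) /\ forall i, linear (Uterm lst i (ct i)).
Proof.
split=> [UP|[ll lt]]; last by move=> _ [] *; rewrite /LL /= ?linear_emb.
split=> [|i].
  rewrite -linear_emb; case: (posnP (ncond rho)) => [n0|n_gt0].
    exact: UP (Uopt_uncond lst n0).
  exact: UP (Uopt_first lst (i := Ordinal n_gt0) erefl).
case: (ord_last_or_succ i) => [ilast|[j ij]].
  exact: UP (Uopt_last lst ilast).
exact: UP (Uopt_step lst ij).
Qed.

(** Dually, [emb (rhs rho)] ends the unconditional or last rule, and [Uterm i (cs i)] ends the first
    rule or the step from the preceding index. *)
Lemma Uopt_RL :
  Uopt_has rho lst (@RL _ _ V) <->
    linear (rhs rho) /\ forall i, linear (Uterm lst i (cs i)).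
Proof.
split=> [UP|[lr ls]]; last by move=> _ [] *; rewrite /RL /= ?linear_emb.
split=> [|i].
  rewrite -linear_emb; case: (posnP (ncond rho)) => [n0|n_gt0].
    exact: UP (Uopt_uncond lst n0).
  have lt_n : (ncond rho).-1 < ncond rho by rewrite prednK.
  exact: UP (Uopt_last lst (i := Ordinal lt_n) (prednK n_gt0)).
case: (ord_first_or_pred i) => [i0|[j ij]].
  exact: UP (Uopt_first lst i0).
exact: UP (Uopt_step lst ij).
Qed.

Lemma vars_later_csP i x :
  reflect (x \in vars (rhs rho) \/ exists2 j : 'I_(ncond rho), i < j & x \in vars (cs j))
    (x \in vars (rhs rho)
       `|` \bigcup_(j <- enum 'I_(ncond rho) | i < j) vars (cs j)).
Proof.
rewrite in_fsetU; apply: (iffP orP) => -[xr|]; [by left| |by left|].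
  by case/bigfcupP => j /andP[_ ij] xj; right; exists j.
by case=> j ij xj; right; apply/bigfcupP; exists j; rewrite // mem_enum.
Qed.

Lemma vars_all_csP x :
  reflect (x \in vars (rhs rho) \/ exists j, x \in vars (cs j))
    (x \in vars (rhs rho) `|` \bigcup_(j <- enum 'I_(ncond rho)) vars (cs j)).
Proof.
rewrite in_fsetU; apply: (iffP orP) => -[xr|]; [by left| |by left|].
  by case/bigfcupP => j _ xj; right; exists j.
by case=> j xj; right; apply/bigfcupP; exists j; rewrite // mem_enum.
Qed.

(** Induction on the distance of [i] from the end. Keeping [Zvars i] on the left makes it close: the
    rule leaving [i] leads into [cs j] and [Zvars j] with [j] the successor of [i], and the
    hypothesis at [j] covers [Zvars j]. *)
Lemma Uopt_NE_later_cs : Uopt_has rho lst (@NE _ _ V) -> forall i,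
  vars (ct i) `|` Zvars i `<=`
    vars (rhs rho) `|` \bigcup_(j <- enum 'I_(ncond rho) | i < j) vars (cs j).
Proof.
move=> UP i; have [m] := ubnP (ncond rho - i); elim: m i => // m IH i.
rewrite ltnS => le_m; case: (ord_last_or_succ i) => [ilast|[j ij]].
  have := UP _ (Uopt_last lst ilast); rewrite /NE /= vars_Uterm vars_emb => sub.
  exact: fsubset_trans sub (fsubsetUl _ _).
have := UP _ (Uopt_step lst ij); rewrite /NE /= !vars_Uterm => sub.
apply: fsubset_trans sub _; apply/fsubsetP => x; rewrite in_fsetU => /orP[xj|xj].
  by apply/vars_later_csP; right; exists j; rewrite // -ltnS -ij.
have lt_m : ncond rho - j < m.
  by apply: leq_trans le_m; rewrite [X in _ - X]ij ltn_sub2l.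
have := fsubsetP (IH j lt_m) x; rewrite in_fsetU xj orbT => /(_ isT).
case/vars_later_csP=> [xr|[j' jj' xj']]; first by apply/vars_later_csP; left.
by apply/vars_later_csP; right; exists j' => //; apply: ltn_trans jj'; rewrite ij.
Qed.

Lemma Uopt_NE :
  Uopt_has rho lst (@NE _ _ V) <->
    vars (lhs rho) `<=`
      vars (rhs rho) `|` \bigcup_(j <- enum 'I_(ncond rho)) vars (cs j) /\
    (forall i,
       vars (ct i) `<=`
         vars (rhs rho)
           `|` \bigcup_(j <- enum 'I_(ncond rho) | i < j) vars (cs j)).
Proof.
split=> [UP|[subl subt]].
  split=> [|i]; last exact: fsubset_trans (fsubsetUl _ _) (Uopt_NE_later_cs UP i).
  case: (posnP (ncond rho)) => [n0|n_gt0].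
    have := UP _ (Uopt_uncond lst n0); rewrite /NE /= !vars_emb => sub.
    exact: fsubset_trans sub (fsubsetUl _ _).
  pose i := Ordinal n_gt0.
  have := UP _ (Uopt_first lst (i := i) erefl).
  rewrite /NE /= vars_Uterm vars_emb => sub; apply: fsubset_trans sub _.
  apply/fsubsetP => x; rewrite in_fsetU => /orP[xi|xi].
    by apply/vars_all_csP; right; exists i.
  have := fsubsetP (Uopt_NE_later_cs UP i) x; rewrite in_fsetU xi orbT => /(_ isT).
  case/vars_later_csP=> [xr|[j _ xj]]; first by apply/vars_all_csP; left.
  by apply/vars_all_csP; right; exists j.
move=> _ [n0|i i0|i j ij|i ilast]; rewrite /NE /= ?vars_Uterm ?vars_emb.
- apply/fsubsetP => x /(fsubsetP subl) /vars_all_csP[//|[j _]].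
  by case: j => j; rewrite {1}n0.
- apply/fsubsetP => x xl; rewrite in_fsetU in_fsetI; apply/orP.
  have xX : x \in Xvars i by apply/XvarsP; left.
  rewrite xX /=; have /vars_all_csP[xr|[j xj]] := fsubsetP subl x xl.
    by right; apply/YvarsP/Or31.
  (* As [i] is 0, the index [j] is either later, so that [x] is passed on through [Zvars i], or [i]
     itself, so that [x] occurs in [cs i]. *)
  have [ij|] := boolP (i < j); first by right; apply/YvarsP/Or33; exists j.
  rewrite -leqNgt [val i]i0 leqn0 -i0 => /eqP/val_inj ji.
  by left; rewrite -ji.
(* A variable needed after condition [i] either occurs in [cs j], with [j] the successor of [i], or
   is still needed later and so lies in [Yvars j]. *)
- have late x : x \in vars (rhs rho) \/
        (exists2 j' : 'I_(ncond rho), i < j' & x \in vars (cs j')) ->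
      x \in vars (cs j) \/ x \in Yvars j.
    case=> [xr|[j' ij' xj']]; first by right; apply/YvarsP/Or31.
    move: ij'; rewrite -[i < j']/(i.+1 <= j') -ij leq_eqVlt.
    case/orP=> [/eqP/val_inj jj'|jj']; first by left; rewrite jj'.
    by right; apply/YvarsP/Or33; exists j'.
  apply/fsubsetP => x; rewrite !in_fsetU !in_fsetI => xtZ; apply/orP.
  (* Passing from [i] to its successor [j] adds exactly the variables of [ct i] to [Xvars], so the
     whole left side lies in [Xvars j]; only [Yvars j] or [cs j] remains to be reached. *)
  have xX : x \in Xvars j.
    apply/XvarsP; case/orP: xtZ => [xi|/andP[/XvarsP[xl|[j' j'i xj']] _]].
    + by right; exists i; rewrite // ij.
    + by left.
    by right; exists j' => //; rewrite ij; apply: ltnW.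
  rewrite xX /=; case/orP: xtZ => [|/andP[_ /YvarsP[xr|[j' le_ij' xj']|xs]]].
  + by move=> /(fsubsetP (subt i)) /vars_later_csP/late.
  + by apply: late; left.
  + move: le_ij'; rewrite leq_eqVlt => /orP[/eqP/val_inj ij'|lt_ij'].
      by rewrite -ij' in xj'; move/(fsubsetP (subt i))/vars_later_csP/late: xj'.
    by right; apply/YvarsP/Or32; exists j'; rewrite ?ij.
  by apply: late; right.
(* At the last index no later condition exists, so [Yvars i] reduces to the variables of [rhs rho]
   and [ct i]. *)
- have nolater j : (i < j) = false by rewrite ltnNge -ltnS ilast ltn_ord.
  have subti : vars (ct i) `<=` vars (rhs rho).
    apply/fsubsetP => x /(fsubsetP (subt i)) /vars_later_csP[//|[j]].
    by rewrite nolater.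
  rewrite fsubUset subti; apply/fsubsetP => x; rewrite in_fsetI => /andP[_].
  case/YvarsP=> [//|[j]|[j]]; last by rewrite nolater.
  rewrite leq_eqVlt nolater orbF => /eqP/val_inj <-; exact: fsubsetP.
Qed.

End Unraveling.

Theorem theorem3p8 (F : Type) (ar : F -> nat) (V : choiceType)
    (lst : {fset V} -> seq V) (hlst : listing lst)
    (rho : crule ar V) (hdet : deterministic rho) :
  [/\ Uopt_has rho lst (@LL _ _ V) <->
        [/\ linear (lhs rho),
            forall i : 'I_(ncond rho), linear (ct i)
          & forall i : 'I_(ncond rho), vars (ct i) `&` Xvars i = fset0],
      Uopt_has rho lst (@RL _ _ V) <->
        [/\ linear (rhs rho),
            forall i : 'I_(ncond rho), linear (cs i)
          & forall i : 'I_(ncond rho), vars (cs i) `&` Yvars i = fset0]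
    & Uopt_has rho lst (@NE _ _ V) <->
        vars (lhs rho) `<=`
          vars (rhs rho) `|` \bigcup_(j <- enum 'I_(ncond rho)) vars (cs j) /\
        (forall i : 'I_(ncond rho),
           vars (ct i) `<=`
             vars (rhs rho)
               `|` \bigcup_(j <- enum 'I_(ncond rho) | i < j) vars (cs j))].
Proof.
split; last exact: Uopt_NE.
- rewrite Uopt_LL; split=> [[ll lt]|[ll lt dis]].
    by split=> // i; have := lt i; rewrite linear_Uterm_ct // => /andP[? /eqP].
  by split=> // i; rewrite linear_Uterm_ct // lt dis eqxx.
rewrite Uopt_RL; split=> [[lr ls]|[lr ls dis]].
  by split=> // i; have := ls i; rewrite linear_Uterm_cs // => /andP[? /eqP].
by split=> // i; rewrite linear_Uterm_cs // ls dis eqxx.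
Qed.
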